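(* Let $Z$ be a uniformly distributed $U(N)$-valued random variable. Then for each $y\in\mathbb C$, $$\mathbb E\bigl(\det(yI_N-Z)\bigr)=y^N.$$
   Context: $U(N)$ is the group of unitary $N\times N$ matrices; uniformly distributed means distributed according to the normalized Haar measure. $I_N$ is the identity matrix. *)

(* Defs.v *)
From HB Require Import structures.
From mathcomp Require Import all_boot all_order all_algebra complex.
From mathcomp Require Import all_classical all_reals all_analysis.
Import Order.TTheory GRing.Theory Num.Theory numFieldNormedType.Exports.

Set Implicit Arguments.
Unset Strict Implicit.
Unset Printing Implicit Defensive.

Local Open Scope classical_set_scope.
Local Open Scope ring_scope.
Local Open Scope complex_scope.

(* The norm topology of the field R[i], which is not inferred on the concrete
   type R[i]; it gives 'M[R[i]]_N its entrywise topology. *)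
HB.instance Definition _ (R : realType) :=
  PseudoPointedMetric.copy R[i] (R[i]^o).

Definition unitary_matrix (R : realType) (N : nat) :=
  {M : 'M[R[i]]_N | M \is unitarymx}.

Definition unitary_val (R : realType) (N : nat) (U : unitary_matrix R N) :
  'M[R[i]]_N := val U.

(* U(N), with the subspace topology. *)
Definition unitary_group (R : realType) (N : nat) :=
  initial_topology (@unitary_val R N).

HB.instance Definition _ (R : realType) (N : nat) :=
  Topological.on (unitary_group R N).

Lemma unitarymx1 (R : realType) (N : nat) :
  (1%:M : 'M[R[i]]_N) \is unitarymx.
Proof. by apply/unitarymxP; rewrite trmx1 map_mx1 mulmx1. Qed.

Definition unitary_one (R : realType) (N : nat) : unitary_group R N :=
  exist _ 1%:M (unitarymx1 R N).

HB.instance Definition _ (R : realType) (N : nat) :=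
  isPointed.Build (unitary_group R N) (unitary_one R N).

Definition unitary_mul (R : realType) (N : nat) (U V : unitary_group R N) :
    unitary_group R N :=
  exist _ (unitary_val U *m unitary_val V)
    (mul_unitarymx (valP (U : unitary_matrix R N))
       (valP (V : unitary_matrix R N))).

(* U(N) as a measurable space, with its Borel sigma-algebra. *)
Definition unitary_borel (R : realType) (N : nat) :=
  g_sigma_algebraType (@open (unitary_group R N)).

HB.instance Definition _ (R : realType) (N : nat) :=
  Measurable.on (unitary_borel R N).

(* The normalized Haar measure of U(N), characterized as the left-invariant
   Borel probability measure. Since U(N) is compact and metrizable, regularity
   and right invariance are automatic. *)
Definition normalized_haar (R : realType) (N : nat)
    (mu : set (unitary_borel R N) -> \bar R) : Prop :=
  mu setT = 1%E /\
  forall (U : unitary_group R N) (A : set (unitary_borel R N)),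
    measurable A -> mu (unitary_mul U @` A) = mu A.

Definition uniformly_distributed (R : realType) (N : nat) (d : measure_display)
    (Omega : measurableType d) (P : probability Omega R)
    (Z : {RV P >-> unitary_borel R N}) : Prop :=
  normalized_haar (distribution P Z).

Definition complex_integrable (R : realType) (d : measure_display)
    (Omega : measurableType d) (P : probability Omega R)
    (X : Omega -> R[i]) : Prop :=
  P.-integrable setT (fun w => (complex.Re (X w))%:E) /\
  P.-integrable setT (fun w => (complex.Im (X w))%:E).

(* Meaningful when X is integrable in the above sense. *)
Definition complex_expectation (R : realType) (d : measure_display)
    (Omega : measurableType d) (P : probability Omega R)
    (X : Omega -> R[i]) : R[i] :=
  fine ('E_P[fun w => complex.Re (X w)])%E +i*
  fine ('E_P[fun w => complex.Im (X w)])%E.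

(* Main.v *)
(* For |c| = 1 the scalar matrix c I is unitary, so Z and cZ have the same law.
   The coefficient a_k of X^k in det(X - Z) satisfies
   c^k a_k(cZ) = c^N a_k(Z), whence (c^k - c^N) E a_k = 0; for k < N, choosing
   c^(N-k) = -1 gives E a_k = 0. Only the leading coefficient 1 survives.
   Every a_k is a polynomial in the entries of Z, which are bounded by 1, so all
   the expectations exist. *)
Require Import Defs.
From mathcomp Require Import all_boot all_order all_algebra complex.
From mathcomp Require Import all_classical all_reals all_analysis.
From mathcomp Require Import measurable_realfun.
Import Order.TTheory GRing.Theory Num.Theory numFieldNormedType.Exports.

Local Open Scope classical_set_scope.
Local Open Scope ring_scope.
Local Open Scope complex_scope.

Set Implicit Arguments.
Unset Strict Implicit.
Unset Printing Implicit Defensive.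

(** * Characteristic polynomials, and bounds by the complex modulus *)

(** Both sides are the coefficient of [X^k] in [det(cX - cA)], which is [c^n det(X - A)] on the one
    hand and the characteristic polynomial of [cA] evaluated at [cX] on the other. Nothing is
    divided by [c], so [c = 0] is allowed. *)
Lemma char_polyZ_coef (F : idomainType) (n : nat) (A : 'M[F]_n) (c : F)
    (k : nat) :
  c ^+ k * (char_poly (c *: A))`_k = c ^+ n * (char_poly A)`_k.
Proof.
have -> : c ^+ n * (char_poly A)`_k = (char_poly (c *: A) \Po (c *: 'X))`_k.
  rewrite -coefCM /char_poly polyC_exp -detZ -det_map_mx.
  congr (polyseq (\det _))`_k.
  apply/matrixP => i j.
  rewrite !mxE /= comp_polyB comp_polyC -mul_polyC mulrBr -rmorphM.
  by rewrite rmorphMn /= comp_polyX mulrnAr mul_polyC.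
rewrite comp_polyE [RHS]coef_sum.
transitivity (\sum_(i < size (char_poly (c *: A)))
    (char_poly (c *: A))`_i * (c ^+ i * (k == i)%:R)); last first.
  by apply: eq_bigr => i _; rewrite coefZ exprZn coefZ coefXn.
(* If [k] is within the size, only the term [i = k] of the composition survives; beyond it, every
   term and the coefficient on the left vanish. *)
have [lt_k|le_k] := ltnP k (size (char_poly (c *: A))).
  rewrite (bigD1 (Ordinal lt_k)) //= eqxx mulr1 big1 ?addr0 1?mulrC // => i.
  rewrite -val_eqE eq_sym /= => /negPf ->.
  by rewrite !mulr0.
rewrite nth_default // mulr0 big1 // => i _.
by rewrite gtn_eqF ?mulr0 // (leq_trans _ le_k).
Qed.

(** Evaluation at [x] is a ring morphism, hence commutes with the determinant. *)
Lemma det_horner_char_poly (F : comNzRingType) (n : nat) (A : 'M[F]_n) (x : F) :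
  \det (x%:M - A) = (char_poly A).[x].
Proof.
rewrite -horner_evalE /char_poly -det_map_mx; congr (\det _).
by apply/matrixP => i j; rewrite !mxE /= horner_evalE !hornerE hornerMn hornerX.
Qed.

(** The diagonal entry [(i, i)] of [A A^* = I] says that the squared moduli along row [i] sum to 1,
    so none of them exceeds 1. *)
Lemma unitarymx_entry_le1 (C : numClosedFieldType) (m n : nat)
    (A : 'M[C]_(m, n)) i j : A \is unitarymx -> `|A i j| <= 1.
Proof.
move=> /unitarymxP/matrixP/(_ i i); rewrite !mxE eqxx => sumA.
rewrite -(@ler_pXn2r _ 2) ?nnegrE ?normr_ge0 // expr1n -[leRHS]sumA.
rewrite (bigD1 j) //= !mxE -normCK lerDl sumr_ge0 // => k _.
by rewrite !mxE -normCK exprn_ge0.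
Qed.

Lemma normc_ge_Im (R : rcfType) (z : R[i]) : `|complex.Im z|%:C <= `|z|.
Proof.
rewrite normc_def lecR -sqrtr_sqr ler_sqrt ?addr_ge0 ?sqr_ge0 //.
by rewrite lerDr sqr_ge0.
Qed.

(** * Bounded measurable complex functions and linearity of the complex expectation *)

Section bounded_measurable.
Context (R : realType) (d : measure_display) (T : measurableType d).
Implicit Types f g : T -> R[i].

(** Unlike integrability, this property is stable under products, so it passes from the entries of a
    matrix to any polynomial in them. Measurability is taken by components to match
    [complex_integrable]. *)
Definition bounded_measurable f :=
  [/\ measurable_fun setT (fun x => complex.Re (f x)),
      measurable_fun setT (fun x => complex.Im (f x)) &
      exists M : R[i], forall x, `|f x| <= M].

Lemma bounded_measurable_cst (c : R[i]) : bounded_measurable (fun=> c).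
Proof. by split; [exact: measurable_cst..|exists `|c|]. Qed.

Lemma bounded_measurableD f g : bounded_measurable f -> bounded_measurable g ->
  bounded_measurable (fun x => f x + g x).
Proof.
move=> [mRf mIf [M fM]] [mRg mIg [M' gM']]; split.
- have -> : (fun x => complex.Re (f x + g x)) =
    (fun x => complex.Re (f x)) \+ (fun x => complex.Re (g x)).
    by apply/funext => x /=; case: (f x); case: (g x).
  exact: measurable_funD.
- have -> : (fun x => complex.Im (f x + g x)) =
    (fun x => complex.Im (f x)) \+ (fun x => complex.Im (g x)).
    by apply/funext => x /=; case: (f x); case: (g x).
  exact: measurable_funD.
- by exists (M + M') => x; rewrite (le_trans (ler_normD _ _)) ?lerD.
Qed.

Lemma bounded_measurableM f g : bounded_measurable f -> bounded_measurable g ->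
  bounded_measurable (fun x => f x * g x).
Proof.
move=> [mRf mIf [M fM]] [mRg mIg [M' gM']]; split.
- have -> : (fun x => complex.Re (f x * g x)) =
    ((fun x => complex.Re (f x)) \* (fun x => complex.Re (g x))) \-
    ((fun x => complex.Im (f x)) \* (fun x => complex.Im (g x))).
    by apply/funext => x /=; case: (f x); case: (g x).
  by apply: measurable_funB; exact: measurable_funM.
- have -> : (fun x => complex.Im (f x * g x)) =
    ((fun x => complex.Re (f x)) \* (fun x => complex.Im (g x))) \+
    ((fun x => complex.Im (f x)) \* (fun x => complex.Re (g x))).
    by apply/funext => x /=; case: (f x); case: (g x).
  by apply: measurable_funD; exact: measurable_funM.
- by exists (M * M') => x; rewrite normrM ler_pM.
Qed.

Lemma bounded_measurable_sum (I : Type) (r : seq I) (Q : pred I)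
    (F : I -> T -> R[i]) : (forall i, bounded_measurable (F i)) ->
  bounded_measurable (fun x => \sum_(i <- r | Q i) F i x).
Proof.
move=> mF; elim: r => [|i r IHr].
  under eq_fun do rewrite big_nil.
  exact: bounded_measurable_cst.
under eq_fun do rewrite big_cons.
by case: (Q i) => //; exact: bounded_measurableD.
Qed.

Lemma bounded_measurable_coef_prod (I : Type) (r : seq I)
    (p : I -> T -> {poly R[i]}) (k : nat) :
  (forall i j, bounded_measurable (fun x => (p i x)`_j)) ->
  bounded_measurable (fun x => (\prod_(i <- r) p i x)`_k).
Proof.
move=> mp; elim: r k => [|i r IHr] k.
  under eq_fun do rewrite big_nil coef1.
  exact: bounded_measurable_cst.
under eq_fun do rewrite big_cons coefM.
by apply: bounded_measurable_sum => j; exact: bounded_measurableM.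
Qed.

(** By the Leibniz formula the coefficient is a sum, over permutations, of signed coefficients of
    products of entries of [X - A]. *)
Lemma bounded_measurable_coef_char_poly (n : nat) (A : T -> 'M[R[i]]_n)
    (k : nat) : (forall i j, bounded_measurable (fun x => A x i j)) ->
  bounded_measurable (fun x => (char_poly (A x))`_k).
Proof.
move=> mA; rewrite /char_poly /determinant; under eq_fun do rewrite coef_sum.
apply: bounded_measurable_sum => s.
(* The sign is rewritten as a constant polynomial, so that it factors out of the coefficient. *)
under eq_fun do rewrite -(rmorph_sign (@polyC R[i])) coefCM.
apply: bounded_measurableM; first exact: bounded_measurable_cst.
apply: bounded_measurable_coef_prod => i j.
under eq_fun do rewrite !mxE coefB coefMn coefX coefC -mulN1r.
apply: bounded_measurableD; first exact: bounded_measurable_cst.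
apply: bounded_measurableM; first exact: bounded_measurable_cst.
by case: (j == 0)%N => //; exact: bounded_measurable_cst.
Qed.

Context (P : probability T R).

Lemma bounded_measurable_integrable f :
  bounded_measurable f -> complex_integrable P f.
Proof.
move=> [mRf mIf [M fM]].
have PT : (P setT < +oo)%E by rewrite probability_setT ltry.
(* The order of [R[i]] compares real parts and equates imaginary parts, so [complex.Re M] is a
   genuine real bound. *)
have bnd (r : R) (x : T) : `|r|%:C <= `|f x| -> `|r| <= complex.Re M.
  by move=> /le_trans/(_ (fM x)); rewrite lecE => /andP[].
split; apply: measurable_bounded_integrable => //.
- exists (complex.Re M); split; first exact: num_real.
  by move=> y My x _; exact: (le_trans (bnd _ x (normc_ge_Re _)) (ltW My)).
- exists (complex.Re M); split; first exact: num_real.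
  by move=> y My x _; exact: (le_trans (bnd _ x (normc_ge_Im _)) (ltW My)).
Qed.

Lemma complex_expectation_cst (c : R[i]) :
  complex_expectation P (fun=> c) = c.
Proof.
rewrite /complex_expectation !(expectation_cst P).
by case: c.
Qed.

Lemma complex_expectationD f g :
  complex_integrable P f -> complex_integrable P g ->
  complex_expectation P (fun x => f x + g x) =
  complex_expectation P f + complex_expectation P g.
Proof.
move=> [iRf iIf] [iRg iIg]; rewrite /complex_expectation unlock.
have -> : (fun x => (complex.Re (f x + g x))%:E) =
    (fun x => (complex.Re (f x))%:E + (complex.Re (g x))%:E)%E.
  by apply/funext => x; case: (f x); case: (g x).
have -> : (fun x => (complex.Im (f x + g x))%:E) =
    (fun x => (complex.Im (f x))%:E + (complex.Im (g x))%:E)%E.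
  by apply/funext => x; case: (f x); case: (g x).
rewrite !integralD //.
(* Integrability excludes infinite integrals, which [fine] sends to 0 and on which it would not be
   additive. *)
case: (integral _ _ _) (integrable_fin_num measurableT iRf) => // a _.
case: (integral _ _ _) (integrable_fin_num measurableT iIf) => // b _.
case: (integral _ _ _) (integrable_fin_num measurableT iRg) => // s _.
by case: (integral _ _ _) (integrable_fin_num measurableT iIg).
Qed.

Lemma complex_expectationZl (c : R[i]) f : complex_integrable P f ->
  complex_expectation P (fun x => c * f x) = c * complex_expectation P f.
Proof.
case: c => a b [iRf iIf]; rewrite /complex_expectation unlock.
have -> : (fun x => (complex.Re ((a +i* b) * f x))%:E) =
    (fun x => a%:E * (complex.Re (f x))%:E - b%:E * (complex.Im (f x))%:E)%E.
  by apply/funext => x; case: (f x).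
have -> : (fun x => (complex.Im ((a +i* b) * f x))%:E) =
    (fun x => a%:E * (complex.Im (f x))%:E + b%:E * (complex.Re (f x))%:E)%E.
  by apply/funext => x; case: (f x).
rewrite integralB ?integralD //; try exact: integrableZl.
rewrite !integralZl //.
case: (integral _ _ _) (integrable_fin_num measurableT iRf) => // r _.
by case: (integral _ _ _) (integrable_fin_num measurableT iIf) => // s _.
Qed.

Lemma complex_expectation_sum (I : Type) (r : seq I) (F : I -> T -> R[i]) :
  (forall i, bounded_measurable (F i)) ->
  complex_expectation P (fun x => \sum_(i <- r) F i x) =
  \sum_(i <- r) complex_expectation P (F i).
Proof.
move=> mF; elim: r => [|i r IHr].
  rewrite big_nil.
  under [X in complex_expectation P X]eq_fun do rewrite big_nil.
  exact: complex_expectation_cst.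
rewrite big_cons -IHr.
under [X in complex_expectation P X]eq_fun do rewrite big_cons.
apply: complex_expectationD; apply: bounded_measurable_integrable => //.
exact: bounded_measurable_sum.
Qed.

End bounded_measurable.

Lemma bounded_measurable_comp (R : realType) (d d' : measure_display)
    (T : measurableType d) (T' : measurableType d') (X : T -> T')
    (f : T' -> R[i]) : measurable_fun setT X ->
  bounded_measurable f -> bounded_measurable (fun x => f (X x)).
Proof.
move=> mX [mRf mIf [M fM]]; split; last by exists M.
- exact: measurableT_comp mRf mX.
- exact: measurableT_comp mIf mX.
Qed.

(** * Topology and Borel structure of [U(N)] *)

Section unitary.
Context (R : realType) (N : nat).

Lemma entry_continuous (i j : 'I_N) :
  continuous (fun U : unitary_group R N => unitary_val U i j : R[i]).
Proof.
move=> U; apply: (@continuous_comp _ _ _ _ (fun M : 'M[R[i]]_N => M i j)).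
  exact: initial_continuous.
exact: (@coord_continuous R[i]).
Qed.

Lemma Re_continuous : continuous (fun z : R[i] => complex.Re z : R).
Proof.
move=> z A /nbhs_ballP[e e0 eA]; apply/nbhs_ballP.
(* Balls of [R[i]] have their radius in [R[i]]. The same radius works because the real part is
   1-Lipschitz. *)
exists e%:C => /=; first by rewrite ltcR.
move=> w zw; apply: eA; move: zw; rewrite /ball /= => zw.
rewrite -ltcR (le_lt_trans _ zw) // (le_trans _ (normc_ge_Re _)) //.
by rewrite raddfB.
Qed.

Lemma Im_continuous : continuous (fun z : R[i] => complex.Im z : R).
Proof.
move=> z A /nbhs_ballP[e e0 eA]; apply/nbhs_ballP.
exists e%:C => /=; first by rewrite ltcR.
move=> w zw; apply: eA; move: zw; rewrite /ball /= => zw.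
rewrite -ltcR (le_lt_trans _ zw) // (le_trans _ (normc_ge_Im _)) //.
by rewrite raddfB.
Qed.

(** Open intervals generate the Borel sets of [R], and their preimages are open, hence among the
    generators of [unitary_borel]. *)
Lemma continuous_measurable_unitary (g : unitary_group R N -> R) :
  continuous g -> measurable_fun [set: unitary_borel R N] g.
Proof.
move=> /continuousP cg; apply: (measurability _ (RGenOpens.measurableE R)).
move=> _ [_ [a [b ->] <-]]; rewrite setTI; apply: sub_sigma_algebra.
exact/cg/interval_open.
Qed.

Lemma bounded_measurable_entry (i j : 'I_N) :
  bounded_measurable (fun U : unitary_borel R N => unitary_val U i j).
Proof.
split.
- apply: (@continuous_measurable_unitary
    (fun U => complex.Re (unitary_val U i j))).
  move=> U; apply: continuous_comp; last exact: Re_continuous.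
  exact: entry_continuous.
- apply: (@continuous_measurable_unitary
    (fun U => complex.Im (unitary_val U i j))).
  move=> U; apply: continuous_comp; last exact: Im_continuous.
  exact: entry_continuous.
- by exists 1 => U; apply/unitarymx_entry_le1/(valP (U : unitary_matrix R N)).
Qed.

(** For the initial topology, continuity is tested after the inclusion into matrices, hence entry by
    entry, and each entry of [UW] is a finite linear combination of entries of [W]. *)
Lemma unitary_mul_continuous (U : unitary_group R N) :
  continuous (unitary_mul U : unitary_group R N -> unitary_group R N).
Proof.
apply: continuous_comp_initial => V A [B MB sBA].
have cvg_entry i j : \forall W \near V,
    B i j ((unitary_val U *m unitary_val W) i j).
  have : continuous (fun W : unitary_group R N =>
      \sum_k unitary_val U i k * unitary_val W k j : R[i]).
    apply: (continuous_big (U := R[i])) => [|k _ W].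
      exact: (@add_continuous R[i]^o).
    apply: cvgMl_tmp; first exact: nbhs_filter.
    exact: entry_continuous.
  move=> /(_ V); rewrite /continuous_at => cVB.
  have {}cVB : nbhs V
      [set W | B i j (\sum_k unitary_val U i k * unitary_val W k j)].
    by apply: cVB; have := MB i j; rewrite /= !mxE.
  by apply: filterS cVB => W /=; rewrite !mxE.
(* There are finitely many positions, so the entrywise neighborhoods can be intersected. *)
have : \forall W \near V, forall ij : 'I_N * 'I_N,
    B ij.1 ij.2 ((unitary_val U *m unitary_val W) ij.1 ij.2).
  apply: (filter_forall (F := nbhs V)) => -[i j]; exact: cvg_entry.
by apply: filterS => W BW; apply: sBA => i j; exact: (BW (i, j)).
Qed.

Lemma measurable_unitary_mul (U : unitary_group R N) :
  measurable_fun [set: unitary_borel R N]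
    (unitary_mul U : unitary_borel R N -> unitary_borel R N).
Proof.
apply: (@measurability _ _ _ (unitary_borel R N) _ _
  (@open (unitary_group R N))) => //.
move=> _ [B oB <-]; rewrite setTI; apply: sub_sigma_algebra.
by move/continuousP: (@unitary_mul_continuous U); apply.
Qed.

(** The witness is [U^* V]. Surjectivity turns invariance under direct images, as in
    [normalized_haar], into invariance under preimages. *)
Lemma unitary_mul_surjective (U V : unitary_group R N) :
  exists W, unitary_mul U W = V.
Proof.
have uU := valP (U : unitary_matrix R N).
have uU' : (unitary_val U ^t*)%sesqui \is unitarymx by rewrite trmxC_unitary.
pose U' : unitary_group R N := exist _ (unitary_val U ^t*)%sesqui uU'.
exists (unitary_mul U' V); apply: val_inj => /=.
by rewrite mulmxA /= (unitarymxP uU) mul1mx.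
Qed.

Lemma unimodular_scalar_unitary (w : R[i]) :
  `|w| = 1 -> w%:M \is @unitarymx R[i] N N.
Proof.
move=> w1; apply/unitarymxP; rewrite tr_scalar_mx map_scalar_mx -scalar_mxM.
by rewrite /= -normCK w1 expr1n.
Qed.

(** * Left invariance of the law of [Z], and the mean coefficients of its characteristic
    polynomial *)

Context (d : measure_display) (Omega : measurableType d).
Context (P : probability Omega R) (Z : {RV P >-> unitary_borel R N}).
Context (hZ : uniformly_distributed Z).

Lemma distribution_unitary_mul (U : unitary_group R N)
    (A : set (unitary_borel R N)) : measurable A ->
  P ((fun w => unitary_mul U (Z w)) @^-1` A) = P (Z @^-1` A).
Proof.
move=> mA; have [_ inv] := hZ.
have mUA : measurable
    ((unitary_mul U : unitary_borel R N -> unitary_borel R N) @^-1` A).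
  by rewrite -[X in measurable X]setTI; exact: measurable_unitary_mul.
(* Invariance is applied to the preimage of [A], whose image under [U] is [A] again. *)
have := inv U _ mUA; rewrite image_preimage; last first.
  apply/seteqP; split => // V _; have [W <-] := unitary_mul_surjective U V.
  by exists W.
exact: esym.
Qed.

(** By change of variables, the components of both sides are integrals against the laws of [UZ] and
    [Z], and these agree on measurable sets. *)
Lemma complex_expectation_unitary_mul (U : unitary_group R N)
    (f : unitary_borel R N -> R[i]) : bounded_measurable f ->
  complex_expectation P (fun w => f (unitary_mul U (Z w))) =
  complex_expectation P (fun w => f (Z w)).
Proof.
move=> mf; have [mRf mIf _] := mf.
pose UZ : Omega -> unitary_borel R N := fun w => unitary_mul U (Z w).
have mZ : measurable_fun setT (Z : Omega -> unitary_borel R N) by [].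
have mUZ : measurable_fun setT UZ.
  exact: measurableT_comp (measurable_unitary_mul U) mZ.
have [iRZ iIZ] :=
  bounded_measurable_integrable P (bounded_measurable_comp mZ mf).
have [iRU iIU] :=
  bounded_measurable_integrable P (bounded_measurable_comp mUZ mf).
have eq_int (g : unitary_borel R N -> R) : measurable_fun setT g ->
    P.-integrable setT (fun w => (g (UZ w))%:E) ->
    P.-integrable setT (fun w => (g (Z w))%:E) ->
    (\int[P]_w (g (UZ w))%:E = \int[P]_w (g (Z w))%:E)%E.
  move=> /measurable_EFinP mg iU iZ.
  rewrite -(integral_pushforward mUZ mg (D := setT)) //.
  rewrite -(integral_pushforward mZ mg (D := setT)) //.
  by apply: eq_measure_integral => A mA _; exact: distribution_unitary_mul.
rewrite /complex_expectation unlock; congr (fine _ +i* fine _).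
- exact: (eq_int _ mRf iRU iRZ).
- exact: (eq_int _ mIf iIU iIZ).
Qed.

Lemma bounded_measurable_char_poly (k : nat) :
  bounded_measurable
    (fun U : unitary_borel R N => (char_poly (unitary_val U))`_k).
Proof. exact/bounded_measurable_coef_char_poly/bounded_measurable_entry. Qed.

Lemma complex_expectation_char_poly (k : nat) :
  complex_expectation P (fun w => (char_poly (unitary_val (Z w)))`_k) =
  (k == N)%:R.
Proof.
have [ltkN|ltNk|->] := ltngtP k N; last 2 first.
(* For [k > N] the coefficient lies beyond the degree and is 0; for [k = N] it is the leading
   coefficient of a monic polynomial. *)
- under [X in complex_expectation P X]eq_fun => w.
    rewrite nth_default ?size_char_poly //; over.
  exact: complex_expectation_cst.
- under [X in complex_expectation P X]eq_fun => w.
    have /monicP := char_poly_monic (unitary_val (Z w)).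
    rewrite lead_coefE size_char_poly /= => ->; over.
  exact: complex_expectation_cst.
pose m := (N - k)%N; have m_gt0 : (0 < m)%N by rewrite subn_gt0.
pose c : R[i] := m.-root (-1).
have cm : c ^+ m = -1 by rewrite rootCK.
have c1 : `|c| = 1.
  by apply/eqP; rewrite -(@pexpr_eq1 _ _ m) ?normr_ge0 // -normrX cm normrN1.
pose U : unitary_group R N := exist _ c%:M (unimodular_scalar_unitary c1).
have iC := bounded_measurable_integrable P
  (bounded_measurable_comp (measurable_funPT Z)
    (bounded_measurable_char_poly k)).
set E := complex_expectation _ _.
(* On the left [Z] is replaced by [UZ = cZ] at no cost; the two integrands then agree pointwise by
   [char_polyZ_coef]. *)
have : c ^+ k * E = c ^+ N * E.
  rewrite -[in RHS]complex_expectationZl //.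
  rewrite /E -(complex_expectation_unitary_mul U
    (bounded_measurable_char_poly k)).
  rewrite -complex_expectationZl; last first.
    apply: bounded_measurable_integrable.
    exact: bounded_measurable_comp (measurableT_comp (measurable_unitary_mul U)
      (measurable_funPT Z)) (bounded_measurable_char_poly k).
  congr complex_expectation; apply/funext => w.
  have -> : unitary_val (unitary_mul U (Z w)) = c *: unitary_val (Z w).
    by rewrite -mul_scalar_mx.
  exact: char_polyZ_coef.
have -> : N = (k + m)%N by rewrite subnKC // ltnW.
(* Since [c^N = - c^k], the identity reads [2 c^k E = 0], and [c] is nonzero because it has modulus
   1. *)
rewrite exprD cm mulrN1 mulNr => /eqP; rewrite -addr_eq0 -mulr2n mulrn_eq0 /=.
rewrite mulf_eq0 expf_eq0 => /orP[/andP[_ /eqP c0]|/eqP //].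
by have /eqP := c1; rewrite c0 normr0 eq_sym oner_eq0.
Qed.

End unitary.

Theorem corollary3p13 (R : realType) (N : nat) (d : measure_display)
    (Omega : measurableType d) (P : probability Omega R)
    (Z : {RV P >-> unitary_borel R N}) (hZ : uniformly_distributed Z)
    (y : R[i]) :
  complex_integrable P (fun w => \det (y%:M - unitary_val (Z w))) /\
  complex_expectation P (fun w => \det (y%:M - unitary_val (Z w))) = y ^+ N.
Proof.
have mC k : bounded_measurable (fun w => (char_poly (unitary_val (Z w)))`_k).
  exact: bounded_measurable_comp (measurable_funPT Z)
    (bounded_measurable_char_poly R N k).
(* The characteristic polynomial has size exactly [N + 1], so the range of summation does not depend
   on [w] and the expectation can enter the sum. *)
have -> : (fun w => \det (y%:M - unitary_val (Z w))) =
    (fun w => \sum_(k < N.+1) y ^+ k * (char_poly (unitary_val (Z w)))`_k).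
  apply/funext => w; rewrite det_horner_char_poly horner_coef size_char_poly.
  by apply: eq_bigr => k _; rewrite mulrC.
have mS (k : 'I_N.+1) : bounded_measurable
    (fun w => y ^+ k * (char_poly (unitary_val (Z w)))`_k).
  by apply: bounded_measurableM => //; exact: bounded_measurable_cst.
split.
  by apply: bounded_measurable_integrable; exact: bounded_measurable_sum.
rewrite complex_expectation_sum //.
rewrite (bigD1 ord_max) //= big1 => [|k kN]; last first.
  rewrite complex_expectationZl; last exact: bounded_measurable_integrable.
  rewrite complex_expectation_char_poly //.
  by rewrite -val_eqE /= in kN; rewrite (negPf kN) mulr0.
rewrite addr0 complex_expectationZl; last exact: bounded_measurable_integrable.
by rewrite complex_expectation_char_poly // eqxx mulr1.
Qed.
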